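(* Let $X$ be a reflexive smooth Banach space over $\mathbb{K}$. Then $X$ has the property (SL) if and only if the following condition is satisfied: for every proper closed subspace $Y\subseteq X$ and for every closed subspace $V\subseteq X/Y$ such that there is a linear surjective isometry $T:X\to V$, the set $k^{-1}(V)\cap Y^{\perp}$ is a linear subspace of $X$, where $k:X\to X/Y$, $k(x)=[x]$, is the canonical surjection.
   Context: $\mathbb{K}$ is $\mathbb{R}$ or $\mathbb{C}$. A proper closed subspace $Y\subseteq X$ means a closed linear subspace with $\{0\}\ne Y\ne X$. $X/Y$ carries the quotient norm. A normed space is smooth if each nonzero vector $x$ has a unique supporting functional $\varphi_x$, i.e. a linear functional with $\|\varphi_x\|=1$ and $\varphi_x(x)=\|x\|$. A semi-inner product on a normed space $X$ over $\mathbb{K}$ (in the sense of Lumer–Giles, generating the norm) is a map $[\cdot|\cdot]:X\times X\to\mathbb{K}$ such that for all $x,y,z\in X$ and $\alpha,\beta,\lambda\in\mathbb{K}$: $[\alpha x+\beta y|z]=\alpha[x|z]+\beta[y|z]$; $[x|\lambda y]=\overline{\lambda}[x|y]$; $|[x|y]|\le\|x\|\,\|y\|$; $[x|x]=\|x\|^2$. On a smooth space it exists and is unique, and is given by $[x|y]=\|y\|\varphi_y(x)$, where $\varphi_0:=0$. A smooth normed space $X$ has the property (SL) if every mapping $f:X\to X$ (not assumed linear, continuous or surjective) satisfying $[f(x)|f(y)]=[x|y]$ for all $x,y\in X$ is linear. Orthogonality in a smooth space: $x\perp y$ means $[y|x]=0$ (note the order), equivalently $\|x\|\le\|x+\alpha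 y\|$ for all $\alpha\in\mathbb{K}$. For $A\subseteq X$, $A^{\perp}=\{x\in X: x\perp a\text{ for every }a\in A\}$ (in general not a linear subspace). *)

(* Defs.v *)
From HB Require Import structures.
From mathcomp Require Import all_boot all_order all_algebra.
From mathcomp Require Import complex.
From mathcomp Require Import all_classical all_reals all_analysis.
From mathcomp Require Import ring.

Set Implicit Arguments.
Unset Strict Implicit.
Unset Printing Implicit Defensive.

Import Order.TTheory GRing.Theory Num.Theory.
Import numFieldNormedType.Exports.
Local Open Scope classical_set_scope.
Local Open Scope ring_scope.

Variant scalar_kind := real_scalars | complex_scalars.

Definition scalarField (R : realType) (k : scalar_kind) : numFieldType :=
  match k with real_scalars => R | complex_scalars => R[i] end.

Section Scalars.
Variables (R : realType) (k : scalar_kind).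
Local Notation K := (scalarField R k).

Definition sconj : K -> K :=
  match k return scalarField R k -> scalarField R k with
  | real_scalars => id
  | complex_scalars => @conjc R
  end.

Definition sRe : K -> R :=
  match k return scalarField R k -> R with
  | real_scalars => id
  | complex_scalars => @complex.Re R
  end.

Definition sReal : R -> K :=
  match k return R -> scalarField R k with
  | real_scalars => id
  | complex_scalars => fun r => (r%:C)%C
  end.
End Scalars.

Section ScalarTheory.
Variables (R : realType) (k : scalar_kind).
Local Notation K := (scalarField R k).
Local Notation sReal := (@sReal R k).

Lemma sRealK : cancel sReal (@sRe R k).
Proof. by case: k. Qed.

Lemma sReal0 : sReal 0 = 0. Proof. by case: k. Qed.

Lemma sRealD x y : sReal (x + y) = sReal x + sReal y.
Proof. by case: k => //=; rewrite rmorphD. Qed.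

Lemma sRealM x y : sReal (x * y) = sReal x * sReal y.
Proof. by case: k => //=; rewrite rmorphM. Qed.

Lemma sRealV x : sReal x^-1 = (sReal x)^-1.
Proof. by case: k => //=; rewrite fmorphV. Qed.

Lemma ler_sReal x y : (sReal x <= sReal y) = (x <= y).
Proof. by case: k => //=; rewrite lecR. Qed.

Lemma ltr_sReal x y : (sReal x < sReal y) = (x < y).
Proof. by case: k => //=; rewrite ltcR. Qed.

Lemma ger0_sRe (x : K) : 0 <= x -> sReal (sRe x) = x.
Proof. by case: k x => //= x x0; apply/RRe_real/ger0_real. Qed.

Lemma normr_conj (x : K) : x * sconj x = `|x| ^+ 2.
Proof.
by case: k x => /= x; [rewrite -expr2 real_normK ?num_real | rewrite sqr_normc].
Qed.

End ScalarTheory.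

(* In a normed module over K the norm `|x| takes its values in K; nrm x is the
   same real number as an element of R, so that sup and inf are available. *)
Definition nrm (R : realType) (k : scalar_kind)
  (V : normedModType (scalarField R k)) (x : V) : R := sRe `|x|.

Section Nrm.
Variables (R : realType) (k : scalar_kind).
Local Notation K := (scalarField R k).
Local Notation sReal := (@sReal R k).
Variable V : normedModType K.
Implicit Types x y : V.

Lemma sReal_nrm x : sReal (nrm x) = `|x|.
Proof. exact/ger0_sRe/normr_ge0. Qed.

Lemma nrm_ge0 x : 0 <= nrm x.
Proof. by rewrite -(@ler_sReal R k) sReal0 sReal_nrm. Qed.

Lemma nrmD x y : nrm (x + y) <= nrm x + nrm y.
Proof. by rewrite -(@ler_sReal R k) sRealD !sReal_nrm ler_normD. Qed.

Lemma nrm0 : nrm (0 : V) = 0.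
Proof. by apply: (can_inj (@sRealK R k)); rewrite sReal_nrm normr0 sReal0. Qed.

Lemma nrm_eq0 x : nrm x = 0 -> x = 0.
Proof. by move=> x0; apply: normr0_eq0; rewrite -sReal_nrm x0 sReal0. Qed.

Lemma nrmZ (a : K) x : nrm (a *: x) = sRe `|a| * nrm x.
Proof.
apply: (can_inj (@sRealK R k)).
by rewrite sRealM !sReal_nrm ger0_sRe// normrZ.
Qed.

End Nrm.

Section Dual.
Variables (R : realType) (k : scalar_kind).
Local Notation K := (scalarField R k).
Variable X : normedModType K.

Definition continuous_functional : {pred X -> K^o} :=
  mem [set f : X -> K^o | linear f /\ continuous f].

Lemma continuous_functionalP (f : X -> K^o) :
  reflect (linear f /\ continuous f) (f \in continuous_functional).
Proof. by apply: (iffP idP); rewrite in_setE. Qed.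

Record dual_space := Dual {
  dual_fun :> X -> K^o;
  dual_funP : dual_fun \in continuous_functional }.

HB.instance Definition _ := [isSub for dual_fun].
HB.instance Definition _ := [Choice of dual_space by <:].

Lemma continuous_functional_closed : submod_closed continuous_functional.
Proof.
split; first by apply/continuous_functionalP; split => [a x y|x];
  [by rewrite [RHS]addr0 [RHS]scaler0 | exact: cst_continuous].
move=> a f g /continuous_functionalP[lf cf] /continuous_functionalP[lg cg].
apply/continuous_functionalP; split => [b x y|x].
  have E z : (a *: f + g) z = a *: f z + g z by [].
  rewrite !E lf lg !scalerDr !scalerA (mulrC a b) -!addrA.
  by congr (_ + _); rewrite addrCA.
apply: continuousD; last exact: cg.
by apply: continuousZl_tmp; exact: cf.
Qed.

HB.instance Definition _ :=
  GRing.SubChoice_isSubLmodule.Build _ _ _ dual_space continuous_functional_closed.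

Lemma dual_is_linear (f : dual_space) : linear f.
Proof. by have /continuous_functionalP[] := dual_funP f. Qed.

HB.instance Definition _ (f : dual_space) :=
  GRing.isLinear.Build K X K^o *:%R (dual_fun f) (dual_is_linear f).

Lemma dual_continuous (f : dual_space) : continuous f.
Proof. by have /continuous_functionalP[] := dual_funP f. Qed.

Definition dual_norm (f : dual_space) : R :=
  sup [set nrm (f x) | x in [set x : X | `|x| <= 1]].

Lemma dual_norm_has_sup (f : dual_space) :
  has_sup [set nrm (f x) | x in [set x : X | `|x| <= 1]].
Proof.
split; first by exists (nrm (f 0)), 0 => //=; rewrite normr0 ler01.
have /linear_bounded_continuous/bounded_funP/(_ 1)[M fM] := @dual_continuous f.
exists (sRe M) => _ [x /= x1 <-].
have M0 : 0 <= M by rewrite (le_trans _ (fM 0 _)) ?normr0.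
by rewrite -(@ler_sReal R k) sReal_nrm ger0_sRe// fM.
Qed.

Lemma dual_norm_bound (f : dual_space) (x : X) : nrm (f x) <= dual_norm f * nrm x.
Proof.
have [->|x0] := eqVneq x 0; first by rewrite linear0 !nrm0 mulr0.
have nx0 : 0 < nrm x.
  by rewrite lt_def nrm_ge0 andbT; apply: contraNneq x0 => /nrm_eq0 ->.
rewrite -ler_pdivrMr//.
have -> : nrm (f x) / nrm x = nrm (f (`|x|^-1 *: x)).
  rewrite linearZ/= nrmZ mulrC; congr (_ * _).
  apply: (can_inj (@sRealK R k)).
  by rewrite ger0_sRe// normfV normr_id sRealV sReal_nrm.
apply: sup_upper_bound; first exact: dual_norm_has_sup.
exists (`|x|^-1 *: x) => //=.
by rewrite normrZ normfV normr_id mulVf// normr_eq0.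
Qed.

Lemma dual_norm_le (f : dual_space) (M : R) :
  (forall x : X, `|x| <= 1 -> nrm (f x) <= M) -> dual_norm f <= M.
Proof.
move=> fM; apply: ge_sup; first by case: (dual_norm_has_sup f).
by move=> _ [x /= x1 <-]; exact: fM.
Qed.

End Dual.

Section Homogeneous.
Variables (R : realType) (k : scalar_kind).
Local Notation K := (scalarField R k).
Local Notation sReal := (@sReal R k).

Lemma seminorm_homogeneous (W : lmodType K) (p : W -> R) :
  (forall w, 0 <= p w) -> (forall a w, p (a *: w) <= sRe `|a| * p w) ->
  forall a w, sReal (p (a *: w)) = `|a| * sReal (p w).
Proof.
move=> p0 pZ a w; rewrite -[`|a|]ger0_sRe// -sRealM; congr sReal; apply/eqP.
rewrite eq_le pZ/=.
have [->|a0] := eqVneq a 0.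
  rewrite normr0 (_ : sRe 0 = 0) ?mul0r//.
  by rewrite -[0 : K](@sReal0 R k) sRealK.
have na0 : 0 < sRe `|a| by rewrite -(@ltr_sReal R k) sReal0 ger0_sRe// normr_gt0.
rewrite -ler_pdivlMl// -[in leLHS](scalerK a0 w).
rewrite (le_trans (pZ _ _))// normfV.
suff -> : sRe (`|a|^-1) = (sRe `|a|)^-1 by [].
by apply: (can_inj (@sRealK R k)); rewrite sRealV !ger0_sRe// invr_ge0.
Qed.

End Homogeneous.

Section DualNormed.
Variables (R : realType) (k : scalar_kind).
Local Notation K := (scalarField R k).
Local Notation sReal := (@sReal R k).
Variable X : normedModType K.

Let dual_normD (f g : dual_space X) :
  sReal (dual_norm (f + g)) <= sReal (dual_norm f) + sReal (dual_norm g).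
Proof.
rewrite -sRealD ler_sReal; apply: dual_norm_le => x x1.
rewrite (le_trans (nrmD _ _))// lerD//.
- by apply: sup_upper_bound; [exact: dual_norm_has_sup|exists x].
- by apply: sup_upper_bound; [exact: dual_norm_has_sup|exists x].
Qed.

Let dual_normZ_le (a : K) (f : dual_space X) :
  dual_norm (a *: f) <= sRe `|a| * dual_norm f.
Proof.
apply: dual_norm_le => x x1.
have -> : nrm ((a *: f) x) = nrm (a *: f x) by [].
rewrite nrmZ ler_wpM2l//; first by rewrite -(@ler_sReal R k) sReal0 ger0_sRe.
by apply: sup_upper_bound; [exact: dual_norm_has_sup|exists x].
Qed.

Let dual_norm_ge0 (f : dual_space X) : 0 <= dual_norm f.
Proof.
apply: le_trans (nrm_ge0 (f 0)) _.
apply: sup_upper_bound; first exact: dual_norm_has_sup.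
by exists 0 => //=; rewrite normr0 ler01.
Qed.

Let dual_normZ := seminorm_homogeneous dual_norm_ge0 dual_normZ_le.

Let dual_norm0_eq0 (f : dual_space X) : sReal (dual_norm f) = 0 -> f = 0.
Proof.
rewrite -(@sReal0 R k) => /(can_inj (@sRealK R k)) f0.
apply/val_inj/funext => x; apply: nrm_eq0; apply/eqP.
by rewrite eq_le nrm_ge0 andbT (le_trans (dual_norm_bound f x))// f0 mul0r.
Qed.

HB.instance Definition _ := @Lmodule_isNormed.Build K (dual_space X)
  (fun f => sReal (dual_norm f)) dual_normD dual_normZ dual_norm0_eq0.

End DualNormed.

Section Subspace.
Variables (R : realType) (k : scalar_kind).
Local Notation K := (scalarField R k).
Variable V : normedModType K.

Definition linear_subspace (A : set V) : Prop := submod_closed (mem A).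

Record closed_subspace := ClosedSubspace {
  subspace_set :> set V;
  subspace_linear : linear_subspace subspace_set;
  subspace_closed : closed subspace_set }.

Definition proper_subspace (Y : closed_subspace) : Prop :=
  (Y : set V) <> [set 0] /\ (Y : set V) <> setT.

Definition subspace_pred (Y : closed_subspace) : {pred V} := mem (Y : set V).

HB.instance Definition _ (Y : closed_subspace) :=
  GRing.isSubmodClosed.Build K V (subspace_pred Y)
    (GRing.submod_closed_semi (subspace_linear Y)).

End Subspace.

Section QuotientSpace.
Variables (R : realType) (k : scalar_kind).
Local Notation K := (scalarField R k).
Local Notation sReal := (@sReal R k).
Variables (X : normedModType K) (Y : closed_subspace X).

Definition quotient_space := Quotient.quot (subspace_pred Y).
HB.instance Definition _ := GRing.Zmodule.on quotient_space.
HB.instance Definition _ := Quotient.on quotient_space.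

Definition quotient_map (x : X) : quotient_space := (\pi_quotient_space x)%qT.

Lemma quotient_mapP (x y : X) : quotient_map x = quotient_map y <-> subspace_set Y (x - y).
Proof.
have E : (x - y \in subspace_pred Y) = (quotient_map x == quotient_map y).
  exact: Quotient.idealrBE.
by split => [/eqP|xyY]; rewrite -?E ?in_setE//; apply/eqP; rewrite -E in_setE.
Qed.

Lemma quotient_map_surj (z : quotient_space) : quotient_map (repr z) = z.
Proof. exact: reprK. Qed.

Lemma quotient_map_is_zmod_morphism : zmod_morphism quotient_map.
Proof. by move=> x y; rewrite /quotient_map !piE. Qed.

Definition quotient_scale (a : K) (z : quotient_space) : quotient_space :=
  quotient_map (a *: repr z).

Lemma quotient_scaleE (a : K) (x : X) :
  quotient_scale a (quotient_map x) = quotient_map (a *: x).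
Proof.
apply/quotient_mapP; rewrite -scalerBr.
have : repr (quotient_map x) - x \in subspace_pred Y.
  by rewrite in_setE; apply/quotient_mapP; exact: quotient_map_surj.
by move=> /(rpredZ a); rewrite in_setE.
Qed.

Lemma quotient_mapD (x y : X) :
  quotient_map (x + y) = quotient_map x + quotient_map y.
Proof. by rewrite /quotient_map !piE. Qed.

Let quotient_scaleA a b z :
  quotient_scale a (quotient_scale b z) = quotient_scale (a * b) z.
Proof. by rewrite -[z]quotient_map_surj !quotient_scaleE scalerA. Qed.

Let quotient_scale1 : left_id 1 quotient_scale.
Proof. by move=> z; rewrite -[z]quotient_map_surj quotient_scaleE scale1r. Qed.

Let quotient_scaleDr : right_distributive quotient_scale +%R.
Proof.
move=> a z w; rewrite -[z]quotient_map_surj -[w]quotient_map_surj.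
by rewrite -quotient_mapD !quotient_scaleE scalerDr quotient_mapD.
Qed.

Let quotient_scaleDl z : {morph quotient_scale^~ z : a b / a + b}.
Proof.
move=> a b; rewrite -[z]quotient_map_surj.
by rewrite !quotient_scaleE scalerDl quotient_mapD.
Qed.

HB.instance Definition _ := GRing.Zmodule_isLmodule.Build K quotient_space
  quotient_scaleA quotient_scale1 quotient_scaleDr quotient_scaleDl.

Lemma quotient_map_is_linear : linear quotient_map.
Proof. by move=> a x y; rewrite quotient_mapD -quotient_scaleE. Qed.

HB.instance Definition _ := GRing.isLinear.Build K X quotient_space *:%R
  quotient_map quotient_map_is_linear.

Definition quotient_norm (z : quotient_space) : R :=
  inf [set nrm x | x in quotient_map @^-1` [set z]].

Lemma quotient_norm_has_inf (z : quotient_space) :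
  has_inf [set nrm x | x in quotient_map @^-1` [set z]].
Proof.
split; first by exists (nrm (repr z)), (repr z) => //; exact: quotient_map_surj.
by exists 0 => _ [x _ <-]; exact: nrm_ge0.
Qed.

Lemma quotient_norm_le (x : X) : quotient_norm (quotient_map x) <= nrm x.
Proof.
apply: ge_inf; first by case: (quotient_norm_has_inf (quotient_map x)).
by exists x.
Qed.

Lemma le_quotient_norm (z : quotient_space) (m : R) :
  (forall x, quotient_map x = z -> m <= nrm x) -> m <= quotient_norm z.
Proof.
move=> mx; apply: lb_le_inf; first by case: (quotient_norm_has_inf z).
by move=> _ [x /= xz <-]; exact: mx.
Qed.

Let quotient_norm_ge0 z : 0 <= quotient_norm z.
Proof. by apply: le_quotient_norm => x _; exact: nrm_ge0. Qed.

Let quotient_normD z w :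
  sReal (quotient_norm (z + w)) <= sReal (quotient_norm z) + sReal (quotient_norm w).
Proof.
rewrite -sRealD ler_sReal -lerBlDr; apply: le_quotient_norm => x <-.
rewrite lerBlDl -lerBlDr; apply: le_quotient_norm => y <-.
rewrite lerBlDr -quotient_mapD (le_trans (quotient_norm_le _))//.
by rewrite addrC nrmD.
Qed.

Let quotient_normZ_le (a : K) z :
  quotient_norm (a *: z) <= sRe `|a| * quotient_norm z.
Proof.
have [->|a0] := eqVneq a 0.
  have s0 : sRe (0 : K) = 0 by rewrite -[0 : K](@sReal0 R k) sRealK.
  rewrite scale0r normr0 s0 mul0r -(linear0 quotient_map).
  by rewrite (le_trans (quotient_norm_le _))// nrm0.
have na0 : 0 < sRe `|a| by rewrite -(@ltr_sReal R k) sReal0 ger0_sRe// normr_gt0.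
rewrite -ler_pdivrMl//; apply: le_quotient_norm => x <-.
rewrite ler_pdivrMl// -nrmZ -linearZ; exact: quotient_norm_le.
Qed.

Let quotient_normZ := seminorm_homogeneous quotient_norm_ge0 quotient_normZ_le.

Let quotient_norm0_eq0 z : sReal (quotient_norm z) = 0 -> z = 0.
Proof.
rewrite -(@sReal0 R k) => /(can_inj (@sRealK R k)) z0.
rewrite -[z]quotient_map_surj -(linear0 quotient_map); apply/quotient_mapP.
rewrite subr0; apply: (subspace_closed _).
move=> B /nbhs_ballP[e /= e0 eB].
have [] := @inf_adherent _ _ (sRe e) _ (quotient_norm_has_inf z).
  by rewrite -(@ltr_sReal R k) sReal0 ger0_sRe// ltW.
move=> _ [x /= xz <-]; rewrite -/(quotient_norm z) z0 add0r => xe.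
exists (repr z - x); split.
  by apply/quotient_mapP; rewrite quotient_map_surj xz.
apply: eB; rewrite -ball_normE /=.
by rewrite opprB addrC subrK -sReal_nrm -(ger0_sRe (ltW e0)) ltr_sReal.
Qed.

HB.instance Definition _ := @Lmodule_isNormed.Build K quotient_space
  (fun z => sReal (quotient_norm z)) quotient_normD quotient_normZ
  quotient_norm0_eq0.

Lemma quotient_normrE (z : quotient_space) : `|z| = sReal (quotient_norm z).
Proof. by []. Qed.

End QuotientSpace.

Section SemiInner.
Variables (R : realType) (k : scalar_kind).
Local Notation K := (scalarField R k).
Variable X : normedModType K.

Definition supporting_functional (x : X) (phi : dual_space X) : Prop :=
  `|phi| = 1 /\ phi x = `|x|.

Definition smooth_space : Prop :=
  forall x : X, x != 0 -> exists! phi : dual_space X, supporting_functional x phi.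

Definition reflexive_space : Prop :=
  forall F : dual_space (dual_space X), exists x : X, forall phi : dual_space X, F phi = phi x.

Definition is_semi_inner_product (s : X -> X -> K) : Prop :=
  [/\ forall (a b : K) (x y z : X), s (a *: x + b *: y) z = a * s x z + b * s y z,
      forall (a : K) (x y : X), s x (a *: y) = sconj a * s x y,
      forall x y : X, `|s x y| <= `|x| * `|y| &
      forall x : X, s x x = `|x| ^+ 2].

(* Lemmas sip_semi_inner_product and semi_inner_product_unique: on a smooth
   space, sip is the unique semi-inner product, so the default is not used. *)
Definition sip : X -> X -> K := xget (fun _ _ => 0) is_semi_inner_product.

Definition property_SL : Prop :=
  forall f : X -> X, (forall x y, sip (f x) (f y) = sip x y) -> linear f.

(* The arguments are swapped on purpose: x _|_ y means [y|x] = 0. *)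
Definition sip_orthogonal (x y : X) : Prop := sip y x = 0.

Definition orthogonal_set (A : set X) : set X :=
  [set x | forall a, A a -> sip_orthogonal x a].

End SemiInner.

Section FieldIdentities.
Variable F : fieldType.

Lemma mulfACA (a c n y : F) : c / n * (a * y) = a * c / n * y.
Proof. by ring. Qed.

Lemma mulfKACA (c n y p : F) : n != 0 -> n * y * (c / n * p) = c * (y * p).
Proof. by move=> n0; field. Qed.
End FieldIdentities.

Section SemiInnerTheory.
Variables (R : realType) (k : scalar_kind).
Local Notation K := (scalarField R k).
Local Notation sReal := (@sReal R k).
Variable X : normedModType K.

Let sconj0 : @sconj R k 0 = 0.
Proof. by case: k => //; exact: (@conjc0 R). Qed.

Let norm_sconj (a : K) : `|sconj a| = `|a|.
Proof. by case: k a => //= a; rewrite normcJ. Qed.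

Let sReal1 : sReal 1 = 1. Proof. by case: k. Qed.

Lemma dual_normrE (phi : dual_space X) : `|phi| = sReal (dual_norm phi).
Proof. by []. Qed.

Lemma dual_normr_bound (phi : dual_space X) (x : X) : `|phi x| <= `|phi| * `|x|.
Proof.
by rewrite dual_normrE -!sReal_nrm -sRealM ler_sReal dual_norm_bound.
Qed.

Lemma supporting_functionalP (y : X) (phi : dual_space X) : y != 0 ->
  (forall x, `|phi x| <= `|x|) -> phi y = `|y| -> supporting_functional y phi.
Proof.
move=> y0 phi_le phiy; split=> //; apply/eqP; rewrite eq_le; apply/andP; split.
  rewrite dual_normrE -sReal1 ler_sReal; apply: dual_norm_le => x x1.
  by rewrite -(@ler_sReal R k) sReal_nrm sReal1 (le_trans (phi_le x)).
have := dual_normr_bound phi y; rewrite phiy normr_id.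
by rewrite -ler_pdivrMr ?normr_gt0// divff// normr_eq0.
Qed.

Lemma semi_inner_productE (s : X -> X -> K) (y : X) (phi : dual_space X) :
  smooth_space X -> is_semi_inner_product s -> y != 0 -> supporting_functional y phi ->
  forall x, s x y = `|y| * phi x.
Proof.
move=> smX [sl _ sb sn] y0 phiy x.
have ny : `|y| != 0 by rewrite normr_eq0.
pose f (x : X) : K^o := `|y|^-1 * s x y.
have lf : linear f.
  move=> a u v; rewrite /f -[v in LHS]scale1r sl mul1r mulrDr.
  by congr (_ + _); rewrite [RHS]mulrCA.
have bf u : `|f u| <= `|u|.
  by rewrite normrM normfV normr_id ler_pdivrMl ?normr_gt0// mulrC sb.
pose fL : {linear X -> K^o} := HB.pack f
  (GRing.isLinear.Build K X K^o *:%R f lf).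
have cf : continuous f.
  apply/(linear_bounded_continuous fL)/bounded_funP => r; exists r => u ur.
  exact: le_trans (bf u) ur.
have psiP : f \in @continuous_functional R k X by apply/continuous_functionalP.
have psi1 : supporting_functional y (Dual psiP).
  by apply: supporting_functionalP => //=; rewrite /f sn expr2 mulKf.
have [phi0 [_ phi0u]] := smX y y0.
have <- : Dual psiP = phi by rewrite -(phi0u _ psi1) (phi0u _ phiy).
by rewrite /= /f mulVKf.
Qed.

Lemma semi_inner_product_unique (s t : X -> X -> K) : smooth_space X ->
  is_semi_inner_product s -> is_semi_inner_product t -> s = t.
Proof.
move=> smX sP tP; apply/funext => x; apply/funext => y.
have [->|y0] := eqVneq y 0.
  have [_ sZ _ _] := sP; have [_ tZ _ _] := tP.
  by rewrite -[0 : X](scale0r 0) sZ tZ sconj0 !mul0r.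
have [phi [phiy _]] := smX y y0.
rewrite (semi_inner_productE smX sP y0 phiy).
by rewrite (semi_inner_productE smX tP y0 phiy).
Qed.

Lemma sip_semi_inner_product : smooth_space X -> is_semi_inner_product (@sip R k X).
Proof.
move=> smX; apply: xgetPex.
have /choice[phi phiP] : forall y : X, exists phi : dual_space X,
    y != 0 -> supporting_functional y phi.
  move=> y; have [->|/smX[phi [phiy _]]] := eqVneq y 0; first by exists 0.
  by exists phi.
exists (fun x y => `|y| * phi y x).
split.
- move=> a b x y z /=; rewrite linearD !linearZ/= mulrDr.
  by congr (_ + _); rewrite mulrCA.
- move=> a x y /=.
  have [->|a0] := eqVneq a 0.
    by rewrite scale0r normr0 sconj0 !mul0r.
  have [->|y0] := eqVneq y 0.
    by rewrite scaler0 normr0 !mul0r mulr0.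
  have ay0 : a *: y != 0 by rewrite scaler_eq0 negb_or a0.
  have na0 : `|a| != 0 by rewrite normr_eq0.
  have [phi1 phiy] := phiP y y0.
  have psi1 : supporting_functional (a *: y) ((sconj a / `|a|) *: phi y).
    apply: supporting_functionalP => // [u|].
      rewrite [_ u]/(_ * phi y u) normrM normrM norm_sconj normfV normr_id.
      by rewrite divff// mul1r (le_trans (dual_normr_bound _ _))// phi1 mul1r.
    have E : phi y (a *: y) = a * `|y| by rewrite linearZ/= phiy.
    have -> : ((sconj a / `|a|) *: phi y) (a *: y) =
        a * sconj a / `|a| * `|y|.
      by rewrite [LHS]/(_ * phi y (a *: y)) E; exact: (@mulfACA K).
    by rewrite normr_conj expr2 mulfK// normrZ.
  have [phi0 [_ phi0u]] := smX _ ay0.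
  have -> : phi (a *: y) = (sconj a / `|a|) *: phi y.
    by rewrite -(phi0u _ psi1) (phi0u _ (phiP _ ay0)).
  have -> : ((sconj a / `|a|) *: phi y) x = sconj a / `|a| * phi y x by [].
  by rewrite normrZ; exact: (@mulfKACA K).
- move=> x y /=; have [->|y0] := eqVneq y 0.
    by rewrite normr0 mulr0 mul0r normr0.
  have [phi1 phiy] := phiP y y0.
  rewrite normrM normr_id mulrC ler_wpM2r//.
  by rewrite (le_trans (dual_normr_bound _ _))// phi1 mul1r.
- move=> x /=; have [->|x0] := eqVneq x 0.
    by rewrite normr0 mul0r expr0n.
  by have [_ ->] := phiP x x0; rewrite expr2.
Qed.

End SemiInnerTheory.

(* Main.v *)
Require Import Defs.
From HB Require Import structures.
From mathcomp Require Import all_boot all_order all_algebra.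
From mathcomp Require Import complex.
From mathcomp Require Import all_classical all_reals all_analysis.
From mathcomp Require Import ring lra.

Set Implicit Arguments.
Unset Strict Implicit.
Unset Printing Implicit Defensive.

Import Order.TTheory GRing.Theory Num.Theory.
Import numFieldNormedType.Exports.
Local Open Scope classical_set_scope.
Local Open Scope ring_scope.

(** A map preserving the semi-inner product is linear modulo a subspace, and the
condition on [k^-1(V) `&` Y^_|_] is what removes the modulo.

Let [f] satisfy [[f x|f y] = [x|y]] and let [Y] be the closed subspace of all
[u] with [[u|f z] = 0] for every [z].  Linearity in the first argument gives
[f (a x + y) - a f x - f y] in [Y], so [T x = k (f x)] is linear; since
[f x] is orthogonal to [Y], passing to the quotient does not shrink it, and [T]
is an isometry from [X] onto a complete, hence closed, subspace [V] of [X/Y].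
If [k^-1(V) `&` Y^_|_] is a linear subspace then it contains the defect
[f (a x + y) - a f x - f y], which also lies in [Y]; a vector of [Y]
orthogonal to [Y] is orthogonal to itself, so the defect vanishes.  This is
[subspace_condition_linear].

Conversely let [T : X -> V] be a surjective linear isometry.  In a reflexive
space every coset contains a vector of minimal norm ([reflexive_proximinal]),
so [T] lifts to some norm-preserving, not obviously linear, [g : X -> X].  Any
such lift preserves the semi-inner product ([isometric_lift_sip]): a norming
functional of [k (g z)] on [X/Y], composed with [T], is a supporting functional
of [z], composed with [k] it is one of [g z], and supporting functionals are
unique.  So (SL) makes every lift linear.  Changing the value of a lift at a
single nonzero point would destroy linearity, hence there is only one lift, and
[k^-1(V) `&` Y^_|_], the set of minimal-norm vectors of the cosets in [V]
([orthogonal_setP]), is its range, a linear subspace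
([SL_linear_subspace]).

Both the proximinality and the description of [Y^_|_] rest on the Hahn-Banach
theorem over the real or complex scalars ([hahn_banach]), used on [X] and on its
dual. *)

(** * Real parts of scalars *)

(** A real-linear functional [U] on a complex space is the real part of the
complex-linear map [x |-> U x - i U (i x)]. *)
Lemma complex_lift (R : realType) (V : lmodType R[i]) (U : V -> R) :
  {morph U : x y / x + y} -> (forall t x, U (t%:C%C *: x) = t * U x) ->
  exists2 F : V -> R[i]^o, linear F & forall x, complex.Re (F x) = U x.
Proof.
move=> UD UZ.
have E (a : R[i]) (z : V) :
    a *: z = (complex.Re a)%:C%C *: z + (complex.Im a)%:C%C *: ('i%C *: z).
  by rewrite scalerA -scalerDl [in LHS](complexE a) (mulrC 'i%C).
have ii (z : V) : 'i%C *: ('i%C *: z) = (-1)%:C%C *: z.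
  by rewrite scalerA -expr2 sqr_i rmorphN.
exists (fun x => Complex (U x) (- U ('i%C *: x))) => // a x y.
rewrite scalerDr (scalerA 'i%C a x) (mulrC 'i%C a) -scalerA.
rewrite (E a x) (E a ('i%C *: x)) ii !UD !UZ.
by case: a => ar ai /=; congr (Complex _ _); ring.
Qed.

Section RealPart.
Variables (R : realType) (k : scalar_kind).
Local Notation K := (scalarField R k).

Lemma sReD (a b : K) : sRe (a + b) = sRe a + sRe b.
Proof. by case: k a b => //= -[a1 a2] [b1 b2]. Qed.

Lemma sReMl (r : R) (a : K) : sRe (sReal k r * a) = r * sRe a.
Proof. by case: k a => //= -[a1 a2] /=; rewrite mul0r subr0. Qed.

Lemma sReal1 : sReal k (1 : R) = 1.
Proof. by case: k. Qed.

Lemma sRealN (r : R) : sReal k (- r) = - sReal k r.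
Proof. by case: k => //=; rewrite rmorphN. Qed.

Lemma sRe_le_norm (a : K) : sRe a <= sRe `|a|.
Proof.
case: k a => a; first exact: ler_norm.
rewrite -(@ler_sReal R complex_scalars) [leRHS]ger0_sRe ?normr_ge0//.
by apply: le_trans (normc_ge_Re a); have := ler_norm (complex.Re a); rewrite -lecR.
Qed.

(** The choice [a = conj c] turns the hypothesis into [`|c| ^+ 2 = 0]. *)
Lemma sRe_eq0 (c : K) : (forall a : K, sRe (a * c) = 0) -> c = 0.
Proof.
move=> /(_ (sconj c)); rewrite mulrC normr_conj => c0.
apply/eqP; rewrite -normr_eq0 -sqrf_eq0 -[_ ^+ _](@ger0_sRe R k) ?exprn_ge0//.
by rewrite c0 sReal0.
Qed.

Lemma sRe_lift (V : lmodType K) (U : V -> R) :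
  (forall t x y, U (sReal k t *: x + y) = t * U x + U y) ->
  exists2 F : V -> K^o, linear F & forall x, sRe (F x) = U x.
Proof.
move=> UP.
have UD x y : U (x + y) = U x + U y.
  by have := UP 1 x y; rewrite sReal1 scale1r mul1r.
have U0 : U 0 = 0 by apply: (addrI (U 0)); rewrite -UD !addr0.
have UZ t x : U (sReal k t *: x) = t * U x.
  by rewrite -[_ *: x]addr0 UP U0 addr0.
case: k V U UP UD U0 UZ => V U UP UD _ UZ; first by exists U.
exact: complex_lift UD UZ.
Qed.

End RealPart.

(** * The Hahn-Banach theorem *)

Section HahnBanach.
Variables (R : realType) (k : scalar_kind).
Local Notation K := (scalarField R k).
Variables (V : lmodType K) (p : V -> R).
Hypothesis pD : forall x y, p (x + y) <= p x + p y.

(** Partial functionals are encoded by their graphs.  Scalars of [K] act on [V] and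
only the real ones are used here, through [sReal], which spares a second,
real, module structure on [V].  Univalence follows from linearity together with
domination by [p]. *)
Definition rlinear_graph (G : set (V * R)) : Prop :=
  forall t v w, G v -> G w -> G (sReal k t *: v.1 + w.1, t * v.2 + w.2).

Definition below_graph (G : set (V * R)) : Prop := forall v, G v -> v.2 <= p v.1.

Section Sublinear.
Hypothesis pZ : forall (t : R) x, 0 < t -> p (sReal k t *: x) = t * p x.

(** One-dimensional extension step: the admissible values at [x0] are those
between [r - p (v - x0)] and [p (w + x0) - s] for [(v, r)] and [(w, s)] in the
graph, and subadditivity of [p] says that this gap is never empty. *)
Lemma graph_extension (G : set (V * R)) (x0 : V) :
  G (0, 0) -> rlinear_graph G -> below_graph G ->
  exists c, exists2 G' : set (V * R), G `<=` G' &
    [/\ G' (x0, c), rlinear_graph G' & below_graph G'].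
Proof.
move=> G00 Glin Gp.
pose A := [set v.2 - p (v.1 - x0) | v in G].
have AB w : G w -> ubound A (p (w.1 + x0) - w.2).
  move=> Gw _ [v Gv <-].
  rewrite lerBrDr addrAC lerBlDr.
  have := Glin 1 v w Gv Gw; rewrite sReal1 scale1r mul1r => /Gp /=.
  move/le_trans; apply; apply: le_trans (pD _ _); rewrite [_ + (_ - _)]addrC.
  by rewrite addrACA addNr addr0 addrC (addrC w.1).
have A0 : A !=set0 by exists (0 - p (0 - x0)), (0, 0).
have Asup : has_sup A by split=> //; exists (p (0 + x0) - 0); exact: (AB (0, 0)).
pose c := sup A.
have cG v : G v -> v.2 - p (v.1 - x0) <= c.
  by move=> Gv; apply: sup_upper_bound => //; exists v.
have Gc w : G w -> c <= p (w.1 + x0) - w.2.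
  by move=> Gw; apply: ge_sup => //; exact: AB.
have GZ t v : G v -> G (sReal k t *: v.1, t * v.2).
  by move=> Gv; have := Glin t v _ Gv G00; rewrite /= !addr0.
exists c, [set u | exists2 v, G v & exists t,
  u = (v.1 + sReal k t *: x0, v.2 + t * c)].
  move=> v Gv; exists v => //; exists 0.
  by rewrite sReal0 scale0r mul0r !addr0; case: v Gv.
split.
- exists (0, 0) => //; exists 1; by rewrite sReal1 scale1r mul1r !add0r.
- move=> t _ _ [v Gv [r ->]] [w Gw [s ->]] /=.
  exists (sReal k t *: v.1 + w.1, t * v.2 + w.2); first exact: Glin.
  exists (t * r + s) => /=; congr (_, _); last by ring.
  by rewrite sRealD sRealM scalerDl -scalerA scalerDr addrACA.
- move=> _ [v Gv [t ->]] /=.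
  (* Divide by |t|: the lower bound on c is for t < 0, the upper for t > 0. *)
  have [t0|t0|->] := ltgtP t 0.
  + pose u := - t; have u0 : 0 < u by rewrite oppr_gt0.
    have := cG _ (GZ u^-1 v Gv) => /=.
    rewrite -(ler_pM2l u0) mulrBr mulrA divff ?gt_eqF// mul1r -pZ//.
    rewrite scalerBr scalerA -sRealM divff ?gt_eqF// sReal1 scale1r.
    rewrite -scaleNr -sRealN /u opprK mulNr; lra.
  + have := Gc _ (GZ t^-1 v Gv) => /=.
    rewrite -(ler_pM2l t0) mulrBr mulrA divff ?gt_eqF// mul1r -pZ//.
    rewrite scalerDr scalerA -sRealM divff ?gt_eqF// sReal1 scale1r; lra.
  + by rewrite sReal0 scale0r mul0r !addr0; exact: Gp.
Qed.

Lemma real_hahn_banach (G : set (V * R)) :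
  G (0, 0) -> rlinear_graph G -> below_graph G ->
  exists U : V -> R, [/\ forall t x y, U (sReal k t *: x + y) = t * U x + U y,
    forall x, U x <= p x & forall v, G v -> U v.1 = v.2].
Proof.
move=> G00 Glin Gp.
(* Joining G to the members of a chain makes the empty chain harmless. *)
pose P (A : set (V * R)) := rlinear_graph (G `|` A) /\ below_graph (G `|` A).
have [|A [[Alin Ap] Amax]] := @Zorn_bigcup _ P.
  move=> F FP Ftot.
  have pick v w : (G `|` \bigcup_(X in F) X) v -> (G `|` \bigcup_(X in F) X) w ->
      exists2 B, (B = set0 \/ F B) & (G `|` B) v /\ (G `|` B) w.
    move=> [Gv|[B FB Bv]] [Gw|[C FC Cw]].
    - by exists set0; [left|split; left].
    - by exists C; [right|split; [left|right]].
    - by exists B; [right|split; [right|left]].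
    - have [BC|CB] := Ftot B C FB FC.
      + by exists C; [right|split; right => //; exact: BC].
      + by exists B; [right|split; right => //; exact: CB].
  have PB B : B = set0 \/ F B -> P B.
    by case=> [->|/FP//]; rewrite /P setU0.
  have sub B : B = set0 \/ F B -> G `|` B `<=` G `|` \bigcup_(X in F) X.
    move=> [->|FB]; first by rewrite setU0; exact: subsetUl.
    by apply: setUS => v Bv; exists B.
  split=> [t v w Fv Fw|v Fv].
  - have [B BF [Bv Bw]] := pick v w Fv Fw.
    by apply: (sub B BF); apply: (PB B BF).1.
  - by have [B BF [Bv _]] := pick v v Fv Fv; apply: (PB B BF).2.
have H00 : (G `|` A) (0, 0) by left.
have total x : exists c, (G `|` A) (x, c).
  have [c [G' AG' [G'x G'lin G'p]]] := graph_extension x H00 Alin Ap.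
  exists c; apply: contrapT => xA; apply: (Amax G').
    split; first by apply: subset_trans AG'; exact: subsetUr.
    by move=> /(_ _ G'x) ?; apply: xA; right.
  suff -> : P G' = (rlinear_graph G' /\ below_graph G') by [].
  by rewrite /P setUidr//; apply: subset_trans AG'; exact: subsetUl.
have uniq x a b : (G `|` A) (x, a) -> (G `|` A) (x, b) -> a = b.
  have le c d : (G `|` A) (x, c) -> (G `|` A) (x, d) -> c <= d.
    move=> Hc Hd; have := Alin (-1) _ _ Hd Hc.
    have p0 : p 0 = 0.
      by have := pZ 0 (ltr0Sn R 1); rewrite scaler0; lra.
    by rewrite sRealN sReal1 scaleN1r addNr => /Ap /=; rewrite p0; lra.
  by move=> Ha Hb; apply/eqP; rewrite eq_le !le.
have [U UP] := choice total.
exists U; split=> [t x y|x|v Gv].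
- apply: (uniq (sReal k t *: x + y)); first exact: UP.
  exact: (Alin t _ _ (UP x) (UP y)).
- exact: (Ap _ (UP x)).
- by apply: (uniq v.1) => //; left; case: v Gv.
Qed.

End Sublinear.

Hypothesis pZ : forall (a : K) x, p (a *: x) = sRe `|a| * p x.

(** The real theorem applied to the real parts of the graph yields [U], hence a
[K]-linear [F] with real part [U]; rotating [x] so that [F x] becomes a
nonnegative real upgrades [U <= p] to [`|F| <= p]. *)
Lemma hahn_banach (G : set (V * K)) : G (0, 0) ->
  (forall a u v, G u -> G v -> G (a *: u.1 + v.1, a * u.2 + v.2)) ->
  (forall u, G u -> sRe u.2 <= p u.1) ->
  exists F : V -> K^o, [/\ linear F, forall x, sRe `|F x| <= p x &
    forall u, G u -> F u.1 = u.2].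
Proof.
move=> G00 Glin Gp.
have pZ' (t : R) x : 0 < t -> p (sReal k t *: x) = t * p x.
  move=> t0; rewrite pZ ger0_norm; first by rewrite sRealK.
  by rewrite -(@sReal0 R k) ler_sReal ltW.
pose Gr := [set (u.1, sRe u.2) | u in G].
have [|||U [Ulin Up UG]] := @real_hahn_banach pZ' Gr.
- by exists (0, 0) => //=; rewrite -(@sReal0 R k) sRealK.
- move=> t _ _ [u Gu <-] [v Gv <-].
  exists (sReal k t *: u.1 + v.1, sReal k t * u.2 + v.2); first exact: Glin.
  by rewrite /= sReD sReMl.
- by move=> _ [u Gu <-]; exact: Gp.
have [F Flin FU] := sRe_lift Ulin.
pose FL : {linear V -> K^o} := HB.pack F
  (GRing.isLinear.Build K V K^o *:%R F Flin).
have FZ a x : F (a *: x) = a * F x by exact: (linearZ_LR FL).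
exists F; split => //.
- move=> x; have [Fx0|Fx0] := eqVneq (F x) 0.
    rewrite Fx0 normr0 -(@sReal0 R k) sRealK.
    have := pD x (-1 *: x); rewrite scaleN1r addrN -(scale0r 0) -scaleN1r !pZ.
    rewrite normrN1 normr0 -sReal1 sRealK -(@sReal0 R k) sRealK; lra.
  have aF : F ((`|F x| / F x) *: x) = `|F x| by rewrite FZ mulfVK.
  have := Up ((`|F x| / F x) *: x); rewrite -FU aF pZ.
  by rewrite normf_div normr_id divff ?normr_eq0// -sReal1 sRealK mul1r.
- move=> u Gu; apply/eqP; rewrite -subr_eq0; apply/eqP; apply: (@sRe_eq0 R k) => a.
  have Gau : G (a *: u.1, a * u.2) by have := Glin a _ _ Gu G00; rewrite !addr0.
  have /UG /= := imageP (fun u => (u.1, sRe u.2)) Gau.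
  by rewrite -FU FZ mulrBr sReD => ->; rewrite -sReD addrN -(@sReal0 R k) sRealK.
Qed.

End HahnBanach.


(** * Norming functionals and proximinality *)

Section Functionals.
Variables (R : realType) (k : scalar_kind).
Local Notation K := (scalarField R k).
Variable X : normedModType K.

Lemma bounded_dual (F : X -> K^o) (M : K) : linear F ->
  (forall x, `|F x| <= M * `|x|) ->
  exists phi : dual_space X, forall x, phi x = F x.
Proof.
move=> Flin FM.
pose FL : {linear X -> K^o} := HB.pack F
  (GRing.isLinear.Build K X K^o *:%R F Flin).
have cF : continuous F.
  apply/(linear_bounded_continuous FL)/bounded_funP => r.
  exists (`|M| * r) => u ur; apply: le_trans (FM u) _.
  have Mu0 : 0 <= M * `|u| := le_trans (normr_ge0 _) (FM u).
  apply: le_trans (real_ler_norm (ger0_real Mu0)) _.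
  by rewrite normrM normr_id ler_wpM2l.
have FP : F \in @continuous_functional R k X by apply/continuous_functionalP.
by exists (Dual FP).
Qed.

End Functionals.

Section Quotient.
Variables (R : realType) (k : scalar_kind).
Local Notation K := (scalarField R k).
Variables (X : normedModType K) (Y : closed_subspace X).
Local Notation pi := (@quotient_map R k X Y).

Lemma quotient_map_subspace y : (Y : set X) y -> pi y = 0.
Proof. by move=> Yy; rewrite -(linear0 pi); apply/quotient_mapP; rewrite subr0. Qed.

Lemma quotient_map_norm x : `|pi x| <= `|x|.
Proof. by rewrite quotient_normrE -sReal_nrm ler_sReal quotient_norm_le. Qed.

Lemma le_quotient_normr x (m : R) :
  (forall y, (Y : set X) y -> sReal k m <= `|x + y|) -> sReal k m <= `|pi x|.
Proof.
move=> mY; rewrite quotient_normrE ler_sReal; apply: le_quotient_norm => z.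
move=> /quotient_mapP/mY; by rewrite -(@ler_sReal R k) sReal_nrm addrC subrK.
Qed.

(** Hahn-Banach for the seminorm [`|k x|] on [X], starting from the line through
[x0].  The functional is a norming functional of [k x0] on the quotient, pulled
back to [X]. *)
Lemma quotient_norming_functional (x0 : X) : exists phi : dual_space X,
  [/\ forall x, `|phi x| <= `|pi x|, forall y, (Y : set X) y -> phi y = 0 &
      phi x0 = `|pi x0|].
Proof.
pose p x := nrm (pi x).
have [|||||F [Flin Fp FG]] := @hahn_banach R k X p _ _
  [set u | exists a : K, u = (a *: x0, a * `|pi x0|)].
- by move=> x y; rewrite /p linearD nrmD.
- by move=> a x; rewrite /p linearZ nrmZ.
- by exists 0; rewrite scale0r mul0r.
- move=> a _ _ [b ->] [c ->]; exists (a * b + c) => /=.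
  by rewrite scalerDl scalerA mulrDl mulrA.
- move=> _ [a ->] /=; apply: le_trans (sRe_le_norm _) _.
  by rewrite normrM normr_id /p linearZ /nrm normrZ.
have FX x : `|F x| <= `|pi x|.
  by rewrite -sReal_nrm -(@sReal_nrm R k (quotient_space Y)) ler_sReal Fp.
have [phi phiE] : exists phi : dual_space X, forall x, phi x = F x.
  apply: (@bounded_dual R k X F 1) => // x.
  by rewrite mul1r (le_trans (FX x))// quotient_map_norm.
exists phi; split=> [x|y Yy|].
- by rewrite phiE FX.
- apply/eqP; rewrite phiE -normr_le0 (le_trans (FX y))//.
  by rewrite quotient_map_subspace// normr0.
- have := FG (1 *: x0, 1 * `|pi x0|); rewrite /= scale1r mul1r phiE; apply.
  by exists 1; rewrite scale1r mul1r.
Qed.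

Lemma annihilator_bound (phi : dual_space X) :
  (forall y, (Y : set X) y -> phi y = 0) ->
  forall x, `|phi x| <= `|phi| * `|pi x|.
Proof.
move=> phiY x; have [->|phi0] := eqVneq phi 0.
  have -> : (0 : dual_space X) x = 0 by [].
  by rewrite !normr0 mul0r.
have phi_gt0 : 0 < `|phi| by rewrite normr_gt0.
rewrite -ler_pdivrMl//.
have -> : `|phi|^-1 * `|phi x| = sReal k ((nrm phi)^-1 * nrm (phi x)).
  by rewrite sRealM sRealV !sReal_nrm.
apply: le_quotient_normr => y Yy.
rewrite sRealM sRealV !sReal_nrm ler_pdivrMl//.
by rewrite -[phi x]addr0 -(phiY y Yy) -linearD dual_normr_bound.
Qed.

(** Evaluation at [x0] on the annihilator of [Y] has norm at most [`|k x0|].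
Extend it to the whole dual with the same bound; by reflexivity the extension
is evaluation at some [x].  The annihilator of [Y] separates cosets, so
[k x = k x0], and a supporting functional of [x] gives [`|x| <= `|k x0|]. *)
Lemma reflexive_proximinal (x0 : X) : reflexive_space X -> smooth_space X ->
  exists2 x, pi x = pi x0 & `|x| = `|pi x0|.
Proof.
move=> refl sm.
pose p (phi : dual_space X) := nrm (pi x0) * nrm phi.
have [|||||F [Flin Fp FG]] := @hahn_banach R k (dual_space X) p _ _
  [set u : dual_space X * K |
     (forall y, (Y : set X) y -> u.1 y = 0) /\ u.2 = u.1 x0].
- by move=> phi psi; rewrite /p -mulrDr ler_wpM2l ?nrm_ge0 ?nrmD.
- by move=> a x; rewrite /p nrmZ mulrCA.
- by split.
- move=> a u v [uY ->] [vY ->]; split=> //= y Yy.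
  have E : a * u.1 y + v.1 y = 0 :> K by rewrite uY// vY// mulr0 addr0.
  exact: E.
- move=> u [uY ->]; apply: le_trans (sRe_le_norm _) _.
  rewrite -(@ler_sReal R k) ger0_sRe// /p sRealM !sReal_nrm mulrC.
  exact: annihilator_bound.
have [F' F'E] : exists F' : dual_space (dual_space X), forall phi, F' phi = F phi.
  apply: (@bounded_dual R k _ F `|pi x0|) => // phi.
  rewrite -[leLHS](@ger0_sRe R k)// -(sReal_nrm (pi x0)) -(sReal_nrm phi).
  by rewrite -sRealM ler_sReal Fp.
have [x xE] := refl F'.
have pix : pi x = pi x0.
  have [phi [_ phiY phix]] := quotient_norming_functional (x - x0).
  apply/eqP; rewrite -subr_eq0 -linearB -normr_eq0 -phix linearB /= -xE F'E.
  by rewrite (FG (phi, phi x0))//= subrr.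
exists x => //; apply/eqP; rewrite eq_le; apply/andP; split;
  last by rewrite -pix quotient_map_norm.
have [->|x_neq0] := eqVneq x 0; first by rewrite normr0.
have [phi [[phi1 phix] _]] := sm x x_neq0.
have := Fp phi; rewrite -F'E xE phix normr_id /p -(@ler_sReal R k) ger0_sRe//.
by rewrite sRealM !sReal_nrm phi1 mulr1.
Qed.

End Quotient.

(** A filter on the range converging to [z] pulls back to a Cauchy filter on [X],
whose limit is mapped to [z]. *)
Lemma isometry_closed_range (K : numFieldType) (X : completeNormedModType K)
    (W : normedModType K) (T : {linear X -> W}) :
  (forall x, `|T x| = `|x|) -> closed (range T).
Proof.
move=> Tiso z; rewrite closureEcvg => -[F FF [Fz FT]].
pose G := filter_from F (fun B => T @^-1` B).
have GF : ProperFilter G.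
  apply: filter_from_proper; last first.
    move=> B FB.
    have [w [Bw [x _ xw]]] := filter_ex (filterI FB (FT _ (fun _ => id))).
    by exists x; rewrite /= xw.
  apply: filter_from_filter; first by exists setT; exact: filterT.
  by move=> B C FB FC; exists (B `&` C); [exact: filterI|].
have Gc : cauchy G.
  apply: cauchy_exP => e e0.
  have e20 : 0 < e / 2 by rewrite divr_gt0.
  have FB : F (ball z (e / 2)) by apply: Fz; exact: nbhsx_ballx.
  have [w [Bw [x _ xw]]] := filter_ex (filterI FB (FT _ (fun _ => id))).
  exists x; exists (ball z (e / 2)) => // y Bz.
  rewrite -ball_normE /= -Tiso linearB xw.
  by have := ball_splitr Bw Bz; rewrite -ball_normE.
have /cauchy_cvg/cvg_ex[x Gx] := Gc.
exists x => //; apply/eqP; rewrite -subr_eq0; apply/negPn/negP => Txz.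
have d0 : 0 < `|T x - z| / 2 by rewrite divr_gt0// normr_gt0.
have [B FB Bx] := Gx _ (nbhsx_ballx x _ d0).
have FB' : F (ball z (`|T x - z| / 2)) by apply: Fz; exact: nbhsx_ballx.
have [w [[Bw Bz] [y _ yw]]] :=
  filter_ex (filterI (filterI FB FB') (FT _ (fun _ => id))).
have /Bx : (T @^-1` B) y by rewrite /= yw.
rewrite -ball_normE /= -Tiso linearB yw => xw.
move: Bz; rewrite -ball_normE /= => zw.
suff : `|T x - z| < `|T x - z| by rewrite ltxx.
apply: le_lt_trans (ler_distD w (T x) z) _.
by rewrite [ltRHS]splitr ltrD// distrC.
Qed.

(** * Semi-inner products and quotients *)

Section SipTheory.
Variables (R : realType) (k : scalar_kind).
Local Notation K := (scalarField R k).
Variable X : normedModType K.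
Hypothesis smX : smooth_space X.
Local Notation sip := (@sip R k X).

Lemma sip_linear (a : K) (x y z : X) : sip (a *: x + y) z = a * sip x z + sip y z.
Proof.
have [lin _ _ _] := sip_semi_inner_product smX.
by have := lin a 1 x y z; rewrite scale1r mul1r.
Qed.

Lemma sipxx (x : X) : sip x x = `|x| ^+ 2.
Proof. by have [_ _ _ ->] := sip_semi_inner_product smX. Qed.

Lemma sip_dual (z : X) : exists phi : dual_space X, forall x, phi x = sip x z.
Proof.
apply: (@bounded_dual R k X (fun x => sip x z) `|z|) => [a x y|x].
  exact: sip_linear.
by have [_ _ + _] := sip_semi_inner_product smX; rewrite mulrC; apply.
Qed.

Lemma sip_supporting (z : X) (phi : dual_space X) :
  (forall x, `|phi x| <= `|x|) -> phi z = `|z| -> forall x, sip x z = `|z| * phi x.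
Proof.
move=> phi1 phiz x; have [->|z0] := eqVneq z 0.
  have [_ _ b _] := sip_semi_inner_product smX.
  by apply/eqP; rewrite normr0 mul0r -normr_le0 (le_trans (b x 0))// normr0 mulr0.
have := supporting_functionalP z0 phi1 phiz.
by move=> /(semi_inner_productE smX (sip_semi_inner_product smX) z0); apply.
Qed.

(** [Y^_|_] consists of the minimal-norm vectors of the cosets of [Y].  If [u] is
orthogonal to [Y] then [`|u| ^+ 2 = [u + y|u] <= `|u + y| * `|u|]; conversely a
norming functional of [k u] vanishes on [Y] and, when [`|k u| = `|u|], it is
the supporting functional of [u]. *)
Lemma orthogonal_setP (Y : closed_subspace X) (u : X) :
  orthogonal_set Y u <-> `|@quotient_map R k X Y u| = `|u|.
Proof.
split=> [uY|unorm].
  apply/eqP; rewrite eq_le quotient_map_norm/=.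
  have [->|u0] := eqVneq u 0; first by rewrite normr0.
  rewrite -(sReal_nrm u); apply: le_quotient_normr => y Yy; rewrite sReal_nrm.
  have u_gt0 : 0 < `|u| by rewrite normr_gt0.
  rewrite -(ler_pM2r u_gt0) -expr2.
  have sip_uy : sip (u + y) u = `|u| ^+ 2.
    have := sip_linear 1 u y u.
    by rewrite scale1r mul1r sipxx (_ : sip y u = 0) ?addr0//; exact: uY.
  have [_ _ /(_ (u + y) u) + _] := sip_semi_inner_product smX.
  by rewrite sip_uy ger0_norm// exprn_ge0.
have [phi [phi1 phiY phiu]] := quotient_norming_functional Y u.
have phi_le x : `|phi x| <= `|x| := le_trans (phi1 x) (quotient_map_norm _ _).
move=> y Yy; rewrite /sip_orthogonal (sip_supporting phi_le) ?phiu//.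
by rewrite phiY// mulr0.
Qed.

(** Let [phi] come from a norming functional of [k (g z)].  It supports [g z], and
[phi \o g] factors through [T], so it is linear and supports [z]; hence both
sides of the conclusion equal [`|z| * phi (g x)]. *)
Lemma isometric_lift_sip (Y : closed_subspace X) 
    (T : {linear X -> quotient_space Y}) (g : X -> X) : (forall x, `|T x| = `|x|) ->
  (forall x, @quotient_map R k X Y (g x) = T x) -> (forall x, `|g x| = `|x|) ->
  forall x z, sip (g x) (g z) = sip x z.
Proof.
move=> Tiso gT giso x z.
have [phi [phi1 phiY phiz]] := quotient_norming_functional Y (g z).
have phig u v : @quotient_map R k X Y u = @quotient_map R k X Y v -> phi u = phi v.
  move=> /quotient_mapP/phiY; rewrite linearB => /eqP.
  by rewrite subr_eq0 => /eqP.
have [psi psiE] : exists psi : dual_space X, forall u, psi u = phi (g u).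
  apply: (@bounded_dual R k X (phi \o g) 1) => [a u v|u].
    transitivity (phi (a *: g u + g v)); last by rewrite linearP.
    by apply: phig; rewrite gT !linearP /= !gT.
  by rewrite mul1r /= (le_trans (phi1 _))// gT Tiso.
rewrite (@sip_supporting (g z) phi).
- rewrite (@sip_supporting z psi).
  + by rewrite giso psiE.
  + by move=> u; rewrite psiE (le_trans (phi1 _))// gT Tiso.
  + by rewrite psiE phiz gT Tiso.
- by move=> u; apply: le_trans (phi1 u) (quotient_map_norm _ _).
- by rewrite phiz gT Tiso giso.
Qed.

End SipTheory.

(** * Property (SL) and linearity of [k^-1(V) `&` Y^_|_] *)

Section Equivalence.
Variables (R : realType) (k : scalar_kind).
Local Notation K := (scalarField R k).

(** Every norm-preserving lift of [T] is linear, so there is only one, and the set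
in question is its range. *)
Lemma SL_linear_subspace (X : normedModType K) (Y : closed_subspace X)
    (T : {linear X -> quotient_space Y}) :
  reflexive_space X -> smooth_space X -> property_SL X ->
  (forall x, `|T x| = `|x|) ->
  linear_subspace ((@quotient_map R k X Y @^-1` range T) `&` orthogonal_set Y).
Proof.
move=> refl smX SL Tiso.
have /choice[g gP] : forall x, exists u,
    @quotient_map R k X Y u = T x /\ `|u| = `|x|.
  move=> x; have [u uE un] := reflexive_proximinal Y (repr (T x)) refl smX.
  by exists u; rewrite un uE quotient_map_surj Tiso.
have lift_linear h :
    (forall x, @quotient_map R k X Y (h x) = T x /\ `|h x| = `|x|) -> linear h.
  move=> hP; apply: SL.
  by apply: (isometric_lift_sip smX Tiso) => x; case: (hP x).
have g_lin := lift_linear g gP.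
have g_unique x w : @quotient_map R k X Y w = T x -> `|w| = `|x| -> w = g x.
  move=> wT wn; have [x0|x0] := eqVneq x 0.
    have w0 : w = 0 by apply/normr0_eq0; rewrite wn x0 normr0.
    by have [_] := gP x; rewrite w0 x0 normr0 => /normr0_eq0.
  (* Another lift, differing from g only at x; compare the two at x + x. *)
  pose h y := if y == x then w else g y.
  have h_lin : linear h.
    by apply: lift_linear => y; rewrite /h; case: eqVneq => [->|].
  have xx : x + x == x = false by rewrite -subr_eq0 addrK (negbTE x0).
  have := h_lin 1 x x; have := g_lin 1 x x.
  rewrite !scale1r {1}/h xx /h eqxx => -> gw.
  have two_neq0 : 2%:R != 0 :> K by rewrite pnatr_eq0.
  by apply: (scalerI two_neq0); rewrite !scaler_nat !mulr2n gw.
have WE : (@quotient_map R k X Y @^-1` range T) `&` orthogonal_set Y = range g.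
  apply/seteqP; split=> [w [[x _ /= Tx] /(orthogonal_setP smX) wn]|_ [x _ <-]].
    by exists x => //; rewrite (g_unique x w)// -wn -Tx Tiso.
  have [gT gn] := gP x; split; first by exists x.
  by apply/(orthogonal_setP smX); rewrite gT Tiso gn.
rewrite WE; split=> [|a u v]; rewrite !in_setE.
  exists 0 => //; apply/normr0_eq0; have [_ ->] := gP 0; exact: normr0.
by move=> [x _ <-] [y _ <-]; exists (a *: x + y) => //; exact: g_lin.
Qed.

Lemma sip_kernel (X : normedModType K) (A : set X) : smooth_space X ->
  exists Y : closed_subspace X, forall u,
    (Y : set X) u <-> (forall z, A z -> @sip R k X u z = 0).
Proof.
move=> smX; have /choice[phi phiE] := sip_dual smX.
pose S := [set u | forall z, A z -> @sip R k X u z = 0].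
have Slin : linear_subspace S.
  split=> [|a u v]; rewrite !in_setE.
    by move=> z _; rewrite -phiE linear0.
  by move=> uS vS z Az; rewrite sip_linear// uS// vS// mulr0 addr0.
have Scl : closed S.
  have -> : S = \bigcap_(z in A) (phi z @^-1` [set 0]).
    apply/seteqP; split=> u Su z Az; first by rewrite /= phiE; exact: Su.
    by rewrite -phiE; exact: Su.
  apply: closed_bigI => z _; apply: preimage_closed => [u _|].
    exact: dual_continuous.
  exact/accessible_closed_set1/hausdorff_accessible/norm_hausdorff.
by exists (ClosedSubspace Slin Scl).
Qed.

(** The semi-inner product of the linearity defect of [f] with every [f w] is zero,
so [f] is linear modulo [Y], the common kernel of the [[.|f w]]; the hypothesis
at [Y] puts the defect in [Y^_|_] too. *)
Lemma subspace_condition_linear (X : completeNormedModType K) : smooth_space X ->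
  (forall Y : closed_subspace X, proper_subspace Y ->
   forall T : {linear X -> quotient_space Y}, (forall x, `|T x| = `|x|) ->
   linear_subspace ((@quotient_map R k X Y @^-1` range T) `&` orthogonal_set Y)) ->
  property_SL X.
Proof.
move=> smX cond f fsip a x y.
have fnorm z : `|f z| = `|z|.
  by apply/eqP; rewrite -(@eqrXn2 _ 2)// -!(sipxx smX) fsip.
have [Y YE] := sip_kernel (range f) smX.
pose d (b : K) u v := f (b *: u + v) - (b *: f u + f v).
have dY b u v : (Y : set X) (d b u v).
  apply/YE => _ [w _ <-]; rewrite /d -scaleN1r addrC sip_linear// sip_linear//.
  by rewrite !fsip sip_linear// mulN1r addNr.
suff Y0 b u v : d b u v = 0.
  by apply/eqP; rewrite -subr_eq0; apply/eqP; exact: Y0.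
(* The hypothesis speaks of proper Y only; the two extreme cases are immediate. *)
have [Yz|Yz] := pselect ((Y : set X) = [set 0]).
  by have := dY b u v; rewrite Yz.
have f_orth w : orthogonal_set Y (f w).
  by move=> z /YE; apply; exists w.
have [Yt|Yt] := pselect ((Y : set X) = setT).
  have fw0 w : f w = 0.
    have : (Y : set X) (f w) by rewrite Yt.
    move=> /(f_orth w); rewrite /sip_orthogonal sipxx// => /eqP.
    by rewrite sqrf_eq0 normr_eq0 => /eqP.
  by rewrite /d !fw0 scaler0 addr0 subr0.
pose T0 w : quotient_space Y := @quotient_map R k X Y (f w).
have T0lin : linear T0.
  move=> c s t; rewrite /T0 -linearP; apply/quotient_mapP; exact: dY.
pose T : {linear X -> quotient_space Y} := HB.pack T0
  (GRing.isLinear.Build K X (quotient_space Y) *:%R T0 T0lin).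
have Tiso w : `|T w| = `|w|.
  by rewrite -fnorm; apply/(orthogonal_setP smX).
have [] := cond Y (conj Yz Yt) T Tiso; set W := mem _ => W0 Wlin.
have fW w : f w \in W by rewrite in_setE; split; [exists w|].
have dW : d b u v \in W.
  have -> : d b u v = (-1) *: (b *: f u + f v) + f (b *: u + v).
    by rewrite scaleN1r addrC.
  by apply: (Wlin (-1)) => //; apply: (Wlin b).
have [_ /(_ _ (dY b u v))] :
    ((@quotient_map R k X Y @^-1` range T) `&` orthogonal_set Y) (d b u v).
  by rewrite -in_setE.
by rewrite /sip_orthogonal sipxx// => /eqP; rewrite sqrf_eq0 normr_eq0 => /eqP.
Qed.

End Equivalence.

Theorem theorem1p2 (R : realType) (k : scalar_kind)
    (X : completeNormedModType (scalarField R k)) :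
  reflexive_space X -> smooth_space X ->
  property_SL X <->
  (forall Y : closed_subspace X, proper_subspace Y ->
   forall V : closed_subspace (quotient_space Y),
     (exists T : {linear X -> quotient_space Y},
        (forall x : X, `|T x| = `|x|) /\ range T = (V : set (quotient_space Y))) ->
     linear_subspace ((@quotient_map R k X Y @^-1` V) `&` orthogonal_set Y)).
Proof.
move=> refl smX; split=> [SL Y _ V [T [Tiso <-]]|cond].
  exact: SL_linear_subspace.
apply: subspace_condition_linear => // Y Yproper T Tiso.
have TVlin : linear_subspace (range T).
  split=> [|a u v]; rewrite !in_setE; first by exists 0; rewrite ?linear0.
  by move=> [x _ <-] [y _ <-]; exists (a *: x + y); rewrite ?linearP.
apply: (cond Y Yproper (ClosedSubspace TVlin (isometry_closed_range Tiso))).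
by exists T.
Qed.
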